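(* Let $f:\mathbb{R}^n\to\mathbb{R}\cup\{+\infty\}$ be three times continuously differentiable on $\mathrm{dom}(f)$, bounded below, and $F$-based $\kappa$-self-concordant with respect to a convex function $F:\mathbb{R}^n\to\mathbb{R}\cup\{+\infty\}$, for some $\kappa>0$. Consider the Adaptive Regularization Method (ARM) with Option 1 and tolerance $\epsilon>0$. If there exists $\sigma_{\max}>0$ such that $\sigma_j\le\sigma_{\max}$ for all $j\ge0$, then ARM with Option 1 terminates within at most $O(\epsilon^{-2})$ iterations.
   Context: Notation: $\mathrm{dom}(f)=\{x\in\mathbb{R}^n: f(x)<+\infty\}$; $\nabla^2 f(x)[h,h]=h^\top\nabla^2 f(x)h$, and $\nabla^3 f(x)[h,h,h]$ is the third directional derivative of $f$ at $x$ along $h$. For $\kappa>0$, a closed convex function $g:\mathbb{R}^n\to\mathbb{R}\cup\{+\infty\}$ is $\kappa$-self-concordant if $\mathrm{dom}(g)$ is open, $g$ is three times continuously differentiable on $\mathrm{dom}(g)$, and $\nabla^3 g(x)[h,h,h]\le 2\kappa(\nabla^2 g(x)[h,h])^{3/2}$ for all $x\in\mathrm{dom}(g)$, $h\in\mathbb{R}^n$. Given $F:\mathbb{R}^n\to\mathbb{R}\cup\{+\infty\}$, the function $f$ is $F$-based $\kappa$-self-concordant if $\mathrm{dom}(f)\subseteq\mathrm{dom}(F)$, $g=f+F$ is $\kappa$-self-concordant, and $\nabla^2 g(x)\succ0$ for all $x\in\mathrm{dom}(f)$. Define $\omega_\star:[0,\infty]\to\mathbb{R}\cup\{+\infty\}$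 by $\omega_\star(z)=-z-\log(1-z)$ if $z<1$ and $\omega_\star(z)=+\infty$ otherwise. Conventions: $\sqrt{x}=+\infty$ for $x<0$; $0\cdot\infty=0$; $\frac00=0$. ARM with Option 1. Parameters: $0<\sigma_{\min}\le\sigma_0$, $0<\eta_1\le\eta_2<1$, $0<\gamma_1<1<\gamma_2<\gamma_3$, tolerance $\epsilon>0$, initial point $x_0\in\mathrm{dom}(f)$. For $j=0,1,2,\dots$: (1) Given a matrix $H_j\in\mathbb{R}^{n\times n}$, set $d_j=-H_j\nabla f(x_j)$, $\rho_j=-\nabla f(x_j)^\top d_j$, $\delta_j=d_j^\top\nabla^2f(x_j)d_j$, $\Delta_j=d_j^\top\nabla^2F(x_j)d_j$, and $m_j(t)=f(x_j)-\rho_jt+\kappa^{-2}\omega_\star(\kappa t\sqrt{\delta_j+\sigma_j\Delta_j})$ for $t\ge0$. Stop and return $x_j$ if $\rho_j\le\epsilon\sqrt{\delta_j+\sigma_j\Delta_j}$ and $\rho_j\ge0$ and $\delta_j+\sigma_j\Delta_j\ge0$. (2) Set $t_j=\arg\min_{t\ge0}m_j(t)$, with $t_j=0$ if this would give $t_j=\infty$ or if the minimizer is not unique. (3) Set $r_j=\frac{f(x_j)-f(x_j+t_jd_j)}{f(x_j)-m_j(t_j)}$, where $f(x_j+t_jd_j)=+\infty$ if $x_j+t_jd_j\notin\mathrm{dom}(f)$. Set $x_{j+1}=x_j+t_jd_j$ if $r_j>\eta_1$ and $x_{j+1}=x_j$ otherwise. Choose any $\sigma_{j+1}\in[\max(\sigma_{\min},\gamma_1\sigma_j),\sigma_j]$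 if $r_j\ge\eta_2$; any $\sigma_{j+1}\in[\sigma_j,\gamma_2\sigma_j]$ if $r_j\in(\eta_1,\eta_2)$; any $\sigma_{j+1}\in[\gamma_2\sigma_j,\gamma_3\sigma_j]$ if $r_j\le\eta_1$. The $O(\cdot)$ is as $\epsilon\to0$, with hidden constant independent of $\epsilon$ (the function, initial point, $\sigma_{\max}$ and other algorithm parameters being fixed).
   Formalization: If r_j = η1 = η2, the rules for r_j ≥ η2 and r_j ≤ η1 conflict (allowing the first would let a rejected step repeat forever with σ unchanged); here the rule for r_j ≤ η1 takes priority: x_{j+1} = x_j and σ_{j+1} lies in [γ2σ_j, γ3σ_j]. *)

(* Defs.v *)
From HB Require Import structures.
From mathcomp Require Import all_boot all_order all_algebra.
From mathcomp Require Import all_classical all_reals all_analysis.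
Set Implicit Arguments.
Unset Strict Implicit.
Unset Printing Implicit Defensive.
Import Order.TTheory GRing.Theory Num.Theory.
Import numFieldNormedType.Exports.
Local Open Scope classical_set_scope.
Local Open Scope ring_scope.

(* A function to R `|` {+oo} is a function to \bar R avoiding -oo. Its
   derivatives are those of [fine \o f]; they are only used at points of an
   open effective domain, so the junk values outside of it do not matter. *)

Definition dom {R : realType} {n : nat} (f : 'cV[R]_n -> \bar R) : set 'cV[R]_n :=
  [set x | (f x < +oo)%E].

Definition gradient {R : realType} {n : nat} (h : 'cV[R]_n -> R) (x : 'cV[R]_n)
    : 'cV[R]_n :=
  \col_i 'D_(delta_mx i 0) h x.

Definition hessian {R : realType} {n : nat} (h : 'cV[R]_n -> R) (x : 'cV[R]_n)
    : 'M[R]_n :=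
  \matrix_(i, j) 'D_(delta_mx i 0) ('D_(delta_mx j 0) h) x.

Definition quadform {R : realType} {n : nat} (A : 'M[R]_n) (v : 'cV[R]_n) : R :=
  (v^T *m A *m v) 0 0.

Definition dotv {R : realType} {n : nat} (u v : 'cV[R]_n) : R := (u^T *m v) 0 0.

Fixpoint Ck_on {R : realType} {n : nat} (k : nat) (U : set 'cV[R]_n)
    (h : 'cV[R]_n -> R) : Prop :=
  if k is k'.+1 then
    (forall x, U x -> differentiable h x) /\ forall v, Ck_on k' U ('D_v h)
  else forall x, U x -> {for x, continuous h}.

(* 0 * +oo = 0 in \bar R, so the endpoints of [0, 1] are harmless. *)
Definition econvex {R : realType} {n : nat} (g : 'cV[R]_n -> \bar R) : Prop :=
  forall (x y : 'cV[R]_n) (t : R), 0 <= t <= 1 ->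
    (g (t *: x + (1 - t) *: y)%R
       <= t%:E * g x + (1 - t)%R%:E * g y)%E.

Definition eclosed {R : realType} {n : nat} (g : 'cV[R]_n -> \bar R) : Prop :=
  closed [set p : 'cV[R]_n * R | (g p.1 <= p.2%:E)%E].

Definition self_concordant {R : realType} {n : nat} (kappa : R)
    (g : 'cV[R]_n -> \bar R) : Prop :=
  [/\ eclosed g, econvex g, open (dom g), Ck_on 3 (dom g) (fine \o g) &
    forall x v : 'cV[R]_n, dom g x ->
      'D_v ('D_v ('D_v (fine \o g))) x
        <= 2 * kappa * quadform (hessian (fine \o g) x) v `^ (3 / 2)].

Definition based_self_concordant {R : realType} {n : nat} (kappa : R)
    (F f : 'cV[R]_n -> \bar R) : Prop :=
  let g := (f \+ F)%E in
  [/\ dom f `<=` dom F, self_concordant kappa g &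
    forall x, dom f x -> forall v : 'cV[R]_n, v != 0 ->
      0 < quadform (hessian (fine \o g) x) v].

Definition omega_star {R : realType} (z : \bar R) : \bar R :=
  if (z < 1)%E then (- fine z - ln (1 - fine z))%:E else +oo%E.

Definition sqrt_oo {R : realType} (a : R) : \bar R :=
  if a < 0 then +oo%E else (Num.sqrt a)%:E.

Record arm_params (R : realType) := ArmParams {
  sigma_min : R; sigma_init : R;
  eta1 : R; eta2 : R;
  gamma1 : R; gamma2 : R; gamma3 : R }.

Definition arm_params_valid {R : realType} (p : arm_params R) : Prop :=
  [/\ 0 < sigma_min p <= sigma_init p,
      [&& 0 < eta1 p, eta1 p <= eta2 p & eta2 p < 1],
      0 < gamma1 p < 1 &
      1 < gamma2 p < gamma3 p].

Section Arm.
Context {R : realType} {n : nat}.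
Variables (f F : 'cV[R]_n -> \bar R) (kappa : R) (p : arm_params R).
Implicit Types (H : 'M[R]_n) (x d : 'cV[R]_n) (sigma t eps : R).

Definition arm_dir H x : 'cV[R]_n := - (H *m gradient (fine \o f) x).

Definition arm_rho x d : R := - dotv (gradient (fine \o f) x) d.

(* delta_j + sigma_j Delta_j *)
Definition arm_curv x d sigma : R :=
  quadform (hessian (fine \o f) x) d
  + sigma * quadform (hessian (fine \o F) x) d.

Definition arm_model x d sigma t : \bar R :=
  (f x - (arm_rho x d * t)%R%:E
   + (kappa ^- 2)%R%:E * omega_star ((kappa * t)%R%:E * sqrt_oo (arm_curv x d sigma)))%E.

Definition arm_stop eps H x sigma : Prop :=
  let d := arm_dir H x in
  [/\ ((arm_rho x d)%:E <= eps%:E * sqrt_oo (arm_curv x d sigma))%E,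
      0 <= arm_rho x d & 0 <= arm_curv x d sigma].

Definition nneg_minimizer (m : R -> \bar R) t : Prop :=
  0 <= t /\ forall s, 0 <= s -> (m t <= m s)%E.

(* With no minimizer on [0, +oo) the argmin would be +oo; t = 0 then, and also
   when the minimizer is not unique. *)
Definition arm_stepsize (m : R -> \bar R) t : Prop :=
  unique (nneg_minimizer m) t
  \/ (~ exists s, unique (nneg_minimizer m) s) /\ t = 0.

(* In \bar R one has 0^-1 = +oo and 0 * +oo = 0, hence 0 / 0 = 0. *)
Definition arm_ratio x d sigma t : \bar R :=
  ((f x - f (x + t *: d)%R) / (f x - arm_model x d sigma t))%E.

(* The test r <= eta1 comes first: when r = eta1 = eta2 the step is rejected,
   and sigma is updated as for any other rejected step. *)
Definition arm_update x d sigma t (x' : 'cV[R]_n) (sigma' : R) : Prop :=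
  let r := arm_ratio x d sigma t in
  if (r <= (eta1 p)%:E)%E then
    x' = x /\ gamma2 p * sigma <= sigma' <= gamma3 p * sigma
  else
    x' = x + t *: d /\
    (if (r < (eta2 p)%:E)%E then sigma <= sigma' <= gamma2 p * sigma
     else Num.max (sigma_min p) (gamma1 p * sigma) <= sigma' <= sigma).

Definition arm_step H x sigma (x' : 'cV[R]_n) (sigma' : R) : Prop :=
  let d := arm_dir H x in
  exists t, arm_stepsize (arm_model x d sigma) t /\ arm_update x d sigma t x' sigma'.

Definition arm_reached eps (H : nat -> 'M[R]_n) (x : nat -> 'cV[R]_n)
    (sigma : nat -> R) (j : nat) : Prop :=
  forall i, (i < j)%N -> ~ arm_stop eps (H i) (x i) (sigma i).

(* The entries of the sequences after the iteration that stops are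
   irrelevant: iterate j.+1 is constrained only if it is reached. *)
Definition arm_run eps (x0 : 'cV[R]_n) (H : nat -> 'M[R]_n)
    (x : nat -> 'cV[R]_n) (sigma : nat -> R) : Prop :=
  [/\ x 0%N = x0, sigma 0%N = sigma_init p &
    forall j, arm_reached eps H x sigma j.+1 ->
      arm_step (H j) (x j) (sigma j) (x j.+1) (sigma j.+1)].

End Arm.

(* Main.v *)
Require Import Defs.
From HB Require Import structures.
From mathcomp Require Import all_boot all_order all_algebra.
From mathcomp Require Import all_classical all_reals all_analysis.
From mathcomp Require Import ring lra.
Set Implicit Arguments.
Unset Strict Implicit.
Unset Printing Implicit Defensive.
Import Order.TTheory GRing.Theory Num.Theory.
Import numFieldNormedType.Exports.
Local Open Scope classical_set_scope.
Local Open Scope ring_scope.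

(** The number of steps is controlled by the model alone.  If the stopping test
    fails at [x] and the step size [t] is not [0], then the slope [rho] of the
    model at [0] exceeds [eps] times [s], where [s] is the square root of the
    curvature.  As [omega_star z <= 2 z^2] for small [z], a well chosen trial
    step shows that the minimum of the model lies at least [eps^2 / 8] below
    [f x], whatever [kappa] is ([arm_model_decrease]).  A step of size [0] has
    ratio [0 / 0 = 0] and is rejected.  Hence each accepted step decreases [f]
    by at least [eta1 * eps^2 / 8], and each rejected one multiplies [sigma] by
    at least [gamma2 > 1] ([arm_step_progress]).

    An accepted step may also shrink [sigma], but at most by the factor
    [gamma1].  So, for [B] of order [eps^-2], the potential
    [ln sigma - B * (f x - M)], with [M] a lower bound of [f], increases by at
    least [ln gamma2] at every step, accepted or not ([arm_run_potential]).  It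
    never exceeds [ln sigma_max], and its initial value is bounded below by a multiple of [- eps^-2];
    so only [O(eps^-2)] steps can precede termination. *)

(** * Bounds on omega_star *)

Lemma omega_star_ge0 (R : realType) (z : \bar R) :
  (0 <= z)%E -> (0 <= omega_star z)%E.
Proof.
rewrite /omega_star; case: z => [z| |] //=.
rewrite lte_fin lee_fin => z0; case: ifP => // z1; rewrite lee_fin.
have := @le_ln1Dx R (- z); rewrite ltrN2 z1 => /(_ isT); lra.
Qed.

(** From [- ln (1 - z) <= z / (1 - z)] one gets
    [omega_star z <= z^2 / (1 - z)], and [1 - z] is at least [1 / 2]. *)
Lemma omega_star_le_sqr (R : realType) (z : R) :
  0 <= z <= 1 / 2 -> (omega_star z%:E <= (2 * z ^+ 2)%:E)%E.
Proof.
move=> /andP[z0 z1]; rewrite /omega_star lte_fin ifT /=; last lra.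
rewrite lee_fin.
have z1_gt0 : 0 < 1 - z by lra.
have : - ln (1 - z) <= z / (1 - z).
  rewrite -lnV ?posrE//.
  have := @le_ln1Dx R (z / (1 - z)).
  have -> : 1 + z / (1 - z) = (1 - z)^-1 by field; rewrite gt_eqF.
  apply; apply: lt_le_trans (divr_ge0 z0 (ltW z1_gt0)); lra.
have : z / (1 - z) <= z + 2 * z ^+ 2.
  rewrite ler_pdivrMr//; nra.
lra.
Qed.

(** * The model and its minimizer *)

Section Model.
Context {R : realType} {n : nat}.
Variables (f F : 'cV[R]_n -> \bar R) (kappa : R).
Hypothesis kappa_gt0 : 0 < kappa.
Variables (x d : 'cV[R]_n) (sigma v : R).
Hypothesis fxE : f x = v%:E.

Local Notation m := (arm_model f F kappa x d sigma).
Local Notation rho := (arm_rho f x d).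
Local Notation curv := (arm_curv f F x d sigma).

Lemma arm_model0 : m 0 = v%:E.
Proof.
rewrite /arm_model fxE !mulr0 mul0e sube0 /omega_star lte_fin ltr01 /=.
by rewrite subr0 ln1 subr0 oppr0 mule0 adde0.
Qed.

Lemma arm_model_ge_linear t : 0 <= t -> ((v - rho * t)%:E <= m t)%E.
Proof.
move=> t0; rewrite /arm_model fxE; apply: leeDl.
apply: mule_ge0; first by rewrite lee_fin invr_ge0 exprn_ge0 // ltW.
apply/omega_star_ge0/mule_ge0; first by rewrite lee_fin mulr_ge0 // ltW.
by rewrite /sqrt_oo; case: ifP => // _; rewrite lee_fin sqrtr_ge0.
Qed.

Lemma arm_model_curv_lt0 t : curv < 0 -> 0 < t -> m t = +oo%E.
Proof.
move=> c0 t0; rewrite /arm_model fxE /sqrt_oo c0.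
rewrite gt0_muley ?lte_fin ?mulr_gt0 // /omega_star /=.
by rewrite gt0_muley // lte_fin invr_gt0 exprn_gt0.
Qed.

Lemma arm_model_le_sqr t z : 0 <= curv -> 0 <= z <= 1 / 2 ->
  z = kappa * t * Num.sqrt curv ->
  (m t <= (v - rho * t + kappa ^- 2 * (2 * z ^+ 2))%:E)%E.
Proof.
move=> c0 z01 zE; rewrite /arm_model fxE /sqrt_oo ltNge c0 /= -EFinM -zE.
rewrite EFinD EFinM.
apply: leeD => //; apply: lee_wpmul2l; last exact: omega_star_le_sqr.
by rewrite lee_fin invr_ge0 exprn_ge0 // ltW.
Qed.

(** A minimizer other than [0] already excludes the degenerate data: with
    negative curvature the model is infinite away from [0], with [rho <= 0] it
    is smallest at [0], and with zero curvature and [rho > 0] it is unbounded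
    below.  There remains the case [rho > eps * s > 0] with [s] the square root
    of the curvature, where a trial step gives the bound. *)
Lemma arm_model_decrease (eps t : R) :
  0 < eps -> kappa * eps <= 2 ->
  ~ [/\ (rho%:E <= eps%:E * sqrt_oo curv)%E, 0 <= rho & 0 <= curv] ->
  unique (nneg_minimizer m) t -> t != 0 ->
  (m t <= (v - eps ^+ 2 / 8)%:E)%E.
Proof.
move=> eps0 keps nstop [[t0 tmin] tuniq] tN0.
have t_gt0 : 0 < t by rewrite lt_neqAle eq_sym tN0.
(* Otherwise [0] would be a second minimizer. *)
have mt_lt : (m t < v%:E)%E.
  rewrite ltNge; apply/negP => vle.
  move/eqP: tN0; apply; apply: tuniq; split=> // s s0.
  by rewrite arm_model0 (le_trans vle) // tmin.
have c0 : 0 <= curv.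
  rewrite leNgt; apply/negP => c0.
  by move: mt_lt; rewrite arm_model_curv_lt0.
have rho_gt0 : 0 < rho.
  rewrite ltNge; apply/negP => r0.
  have := le_lt_trans (arm_model_ge_linear t0) mt_lt.
  by rewrite lte_fin; apply/negP; rewrite -leNgt; nra.
have rho_gt : eps * Num.sqrt curv < rho.
  rewrite ltNge; apply/negP => rle; apply: nstop; split => //; last exact: ltW.
  by rewrite /sqrt_oo ltNge c0 /= -EFinM lee_fin.
have [s0|s_neq0] := eqVneq (Num.sqrt curv) 0.
  (* The model is then affine and decreasing, so [t + 1] beats [t]. *)
  have lower := arm_model_ge_linear t0.
  have z_range : 0 <= (0 : R) <= 1 / 2 by apply/andP; split=> //; lra.
  have zE : 0 = kappa * (t + 1) * Num.sqrt curv by rewrite s0 mulr0.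
  have upper := arm_model_le_sqr c0 z_range zE.
  have t1_ge0 : 0 <= t + 1 by exact: addr_ge0.
  have := le_trans lower (le_trans (tmin _ t1_ge0) upper).
  rewrite lee_fin expr0n /= !mulr0 addr0 => le_next; exfalso; lra.
have s_gt0 : 0 < Num.sqrt curv by rewrite lt_neqAle eq_sym s_neq0 sqrtr_ge0.
set s := Num.sqrt curv in rho_gt s_neq0 s_gt0 *.
(* The trial step u makes the argument [z] of omega_star equal to [kappa eps / 4],
   the maximizer of [eps (z / kappa) - 2 (z / kappa)^2]. *)
pose u := eps / 4 / s.
have u_ge0 : 0 <= u by rewrite !divr_ge0 // ltW.
apply: le_trans (tmin u u_ge0) _.
apply: le_trans (@arm_model_le_sqr u (kappa * eps / 4) c0 _ _) _.
- by apply/andP; split; [rewrite !mulr_ge0 // ltW|lra].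
- by rewrite /u -/s; field.
have : eps / 4 * eps <= rho * u.
  have -> : eps / 4 * eps = eps * s * u by rewrite /u; field.
  by apply: ler_wpM2r => //; apply: ltW.
have -> : kappa ^- 2 * (2 * (kappa * eps / 4) ^+ 2) = eps ^+ 2 / 8.
  by field; rewrite gt_eqF.
rewrite lee_fin; lra.
Qed.

(** If the trial point leaves the domain, the ratio is [-oo] and the step is
    not accepted; so acceptance also yields that [f] is finite at the new
    point. *)
Lemma arm_accepted_decrease (e eta t : R) :
  0 < e -> 0 < eta -> f (x + t *: d) != -oo%E ->
  (m t <= (v - e)%:E)%E -> 0 <= t ->
  (eta%:E < arm_ratio f F kappa x d sigma t)%E ->
  exists2 w, f (x + t *: d) = w%:E & w <= v - eta * e.
Proof.
move=> e0 eta0 fy_noNy mt_le t0.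
have := arm_model_ge_linear t0.
rewrite /arm_ratio fxE; case: (m t) mt_le => [q| |] //.
rewrite lee_fin => q_le _.
have D0 : 0 < v - q by lra.
rewrite -EFinB inver gt_eqF //.
case: (f _) fy_noNy => [w| |] // _; last first.
  by rewrite gt0_mulNye // lte_fin invr_gt0.
rewrite -EFinB -EFinM lte_fin ltr_pdivlMr // => lt; exists w => //.
nra.
Qed.

Lemma arm_ratio0 : arm_ratio f F kappa x d sigma 0 = 0%E.
Proof. by rewrite /arm_ratio scale0r addr0 fxE -EFinB subrr mul0e. Qed.

End Model.

(** * Progress of a step and of a run *)

Section Step.
Context {R : realType} {n : nat}.
Variables (f F : 'cV[R]_n -> \bar R) (kappa : R) (p : arm_params R).
Hypothesis kappa_gt0 : 0 < kappa.
Hypothesis f_noNy : forall x, f x != -oo%E.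
Hypothesis p_valid : arm_params_valid p.

(** The alternative on which the counting rests: a step that does not stop
    either enlarges [sigma] or decreases [f], by amounts fixed in advance. *)
Lemma arm_step_progress (eps : R) H x sigma x' sigma' v :
  0 < eps -> kappa * eps <= 2 -> 0 < sigma -> f x = v%:E ->
  ~ arm_stop f F eps H x sigma ->
  arm_step f F kappa p H x sigma x' sigma' ->
  x' = x /\ gamma2 p * sigma <= sigma' \/
  gamma1 p * sigma <= sigma' /\
    exists2 w, f x' = w%:E & w <= v - eta1 p * (eps ^+ 2 / 8).
Proof.
move: p_valid => [_ /and3P[eta1_gt0 _ _] /andP[g1_gt0 g1_lt1] _].
move=> eps0 keps s_gt0 fxE nstop [t [tstep]].
rewrite /arm_update; set d := arm_dir _ _ _ in nstop tstep *.
case: ifPn => [_ [-> /andP[]]|]; first by left.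
rewrite -ltNge => accepted [-> sigma'_ge]; right.
have tN0 : t != 0.
  apply/eqP => t0; move: accepted.
  by rewrite t0 (arm_ratio0 F kappa d sigma fxE) lte_fin ltNge ltW.
have tuniq : unique (nneg_minimizer (arm_model f F kappa x d sigma)) t.
  by case: tstep => // -[_ /eqP]; rewrite (negPf tN0).
split.
  move: sigma'_ge; case: ifP => _ /andP[].
    by move=> le_s _; nra.
  by rewrite ge_max => /andP[].
have t0 := tuniq.1.1.
apply: (arm_accepted_decrease kappa_gt0 fxE _ _ (f_noNy _) _ t0 accepted) => //.
  by rewrite divr_gt0 // exprn_gt0.
exact: arm_model_decrease keps nstop tuniq tN0.
Qed.

(** The weight [B] will be so large that the decrease of [f] at an accepted
    step outweighs the loss [- ln gamma1] that [ln sigma] may suffer there. *)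
Definition arm_potential (B M : R) (x : 'cV[R]_n) (sigma : R) : R :=
  ln sigma - B * (fine (f x) - M).

(** The hypothesis on [B] makes the gain of an accepted step at least
    [ln gamma2], which is what a rejected step gains through [ln sigma]. *)
Lemma arm_run_potential (eps B M : R) x0 H x sigma N :
  0 < eps -> kappa * eps <= 2 -> dom f x0 -> 0 <= B ->
  ln (gamma2 p) - ln (gamma1 p) <= B * (eta1 p * (eps ^+ 2 / 8)) ->
  arm_run f F kappa p eps x0 H x sigma ->
  arm_reached f F eps H x sigma N ->
  [/\ 0 < sigma N, dom f (x N) &
  arm_potential B M x0 (sigma_init p) + N%:R * ln (gamma2 p)
    <= arm_potential B M (x N) (sigma N)].
Proof.
move=> eps0 keps x0dom B0 Bge [xE sE step].
move: (p_valid) => [/andP[smin_gt0 smin_le] _ /andP[g1_gt0 g1_lt1] /andP[g2_gt1 _]].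
elim: N => [_|N IH reach].
  by rewrite xE sE mul0r addr0; split => //; exact: lt_le_trans smin_le.
have /IH[s_gt0 xdom le_pot] : arm_reached f F eps H x sigma N.
  by move=> i iN; apply: reach; apply: ltnW.
have [v fxE] : exists v, f (x N) = v%:E.
  by move: xdom (f_noNy (x N)); rewrite /dom /=; case: (f _) => // v _ _; exists v.
have g2_gt0 : 0 < gamma2 p by lra.
have nstop : ~ arm_stop f F eps (H N) (x N) (sigma N) by exact: reach.
have [[xS sS]|[sS [w fxS wv]]] :=
    arm_step_progress eps0 keps s_gt0 fxE nstop (step N reach).
  have g2s_gt0 : 0 < gamma2 p * sigma N by rewrite mulr_gt0.
  have sS_gt0 := lt_le_trans g2s_gt0 sS.
  split => //; first by rewrite xS.
  move: sS; rewrite -ler_ln ?posrE // lnM ?posrE // => sS.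
  by move: le_pot; rewrite /arm_potential xS -natr1; lra.
have g1s_gt0 : 0 < gamma1 p * sigma N by rewrite mulr_gt0.
have sS_gt0 := lt_le_trans g1s_gt0 sS.
split => //; first by rewrite /dom /= fxS ltry.
move: sS; rewrite -ler_ln ?posrE // lnM ?posrE // => sS.
move: le_pot; rewrite /arm_potential fxE fxS -natr1 /=.
have := ler_wpM2l B0 wv.
lra.
Qed.

End Step.

(** * The complexity bound *)

Theorem theorem3p4 (R : realType) (n : nat) (f F : 'cV[R]_n -> \bar R)
    (kappa : R) (p : arm_params R) (x0 : 'cV[R]_n) (sigma_max : R)
    (f_noNy : forall x, f x != -oo%E) (F_noNy : forall x, F x != -oo%E)
    (f_C3 : Ck_on 3 (dom f) (fine \o f))
    (f_bounded_below : exists M : R, forall x, (M%:E <= f x)%E)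
    (F_convex : econvex F)
    (kappa_gt0 : 0 < kappa)
    (f_based_sc : based_self_concordant kappa F f)
    (p_valid : arm_params_valid p)
    (x0_dom : dom f x0)
    (sigma_max_gt0 : 0 < sigma_max) :
  exists C : R, \forall eps \near 0^'+,
    forall (H : nat -> 'M[R]_n) (x : nat -> 'cV[R]_n) (sigma : nat -> R),
      arm_run f F kappa p eps x0 H x sigma ->
      (forall j, arm_reached f F eps H x sigma j -> sigma j <= sigma_max) ->
      exists j : nat,
        j.+1%:R <= C * eps ^- 2 /\ arm_stop f F eps (H j) (x j) (sigma j).
Proof.
have [M fM] := f_bounded_below.
have [/andP[smin_gt0 smin_le] /and3P[eta1_gt0 _ _] /andP[g1_gt0 g1_lt1]
  /andP[g2_gt1 _]] := p_valid.
have s0_gt0 : 0 < sigma_init p by exact: lt_le_trans smin_le.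
have c_gt0 : 0 < ln (gamma2 p) by rewrite ln_gt0.
have b_gt0 : 0 < ln (gamma2 p) - ln (gamma1 p).
  by rewrite subr_gt0; apply: lt_trans c_gt0; rewrite ln_lt0 // g1_gt0.
have finM y : dom f y -> M <= fine (f y).
  by move: (fM y) (f_noNy y); rewrite /dom /=; case: (f y).
set b := ln (gamma2 p) - ln (gamma1 p) in b_gt0 *.
set c := ln (gamma2 p) in c_gt0 *.
pose K1 : R := `|ln sigma_max - ln (sigma_init p)|.
pose K2 := 8 * b / eta1 p * (fine (f x0) - M).
pose C : R := (K1 + K2) / c + 1.
exists (C + 1); near=> eps => H x sigma run bounded.
have eps_gt0 : 0 < eps by near: eps; exact: nbhs_right_gt.
have eps_le1 : eps <= 1 by near: eps; exact: nbhs_right_le.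
have keps : kappa * eps <= 2.
  rewrite mulrC -ler_pdivlMr //; near: eps; apply: nbhs_right_le.
  by rewrite divr_gt0.
have ie_ge1 : 1 <= eps ^- 2.
  by rewrite invf_ge1 ?exprn_gt0 // expr_le1 // ltW.
(* Were there no stop up to the bound, iterate [N] would be reached; the two
   extra units in the constant pay for the rounding and for strictness. *)
pose N := Num.truncn ((C + 1) * eps ^- 2).
have K2_ge0 : 0 <= K2.
  by rewrite mulr_ge0 ?subr_ge0 ?finM // divr_ge0 ?mulr_ge0 // ltW.
have C_ge1 : 1 <= C.
  by rewrite lerDr divr_ge0 ?addr_ge0 ?normr_ge0 // ltW.
have C1_ge0 : 0 <= (C + 1) * eps ^- 2.
  by rewrite mulr_ge0; lra.
have [//|none] := pselect (exists j : nat,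
  j.+1%:R <= (C + 1) * eps ^- 2 /\ arm_stop f F eps (H j) (x j) (sigma j)).
exfalso.
have reach : arm_reached f F eps H x sigma N.
  move=> i iN stop; apply: none; exists i; split => //.
  by rewrite -truncn_ge_nat.
pose B := 8 * b / eta1 p * eps ^- 2.
have B_ge0 : 0 <= B.
  by rewrite mulr_ge0 ?divr_ge0 ?mulr_ge0 // ?ltW //; lra.
have Bge : b <= B * (eta1 p * (eps ^+ 2 / 8)).
  rewrite le_eqVlt; apply/orP; left; apply/eqP; rewrite /B; field.
  by rewrite !gt_eqF.
have [s_gt0 xdom] := arm_run_potential kappa_gt0 f_noNy p_valid M
  eps_gt0 keps x0_dom B_ge0 Bge run reach.
rewrite /arm_potential -/c.
have := bounded _ reach; rewrite -ler_ln ?posrE // => lnle.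
have BM : 0 <= B * (fine (f (x N)) - M) by rewrite mulr_ge0 // subr_ge0 finM.
have -> : B * (fine (f x0) - M) = K2 * eps ^- 2 by rewrite /B /K2; ring.
have K1_le : ln sigma_max - ln (sigma_init p) <= K1 * eps ^- 2.
  by apply: le_trans (ler_norm _) _; rewrite ler_peMr.
have Nlt : C * eps ^- 2 < N%:R.
  have := truncnS_gt ((C + 1) * eps ^- 2); rewrite -/N -natr1; lra.
have cN : c * (C * eps ^- 2) < c * N%:R by rewrite ltr_pM2l.
have cC : c * (C * eps ^- 2) = (K1 + K2) * eps ^- 2 + c * eps ^- 2.
  by rewrite /C; field; rewrite !gt_eqF.
have : 0 <= c * eps ^- 2 by rewrite mulr_ge0 ?ltW //; lra.
lra.
Unshelve. all: by end_near.
Qed.
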